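(* Let $\mathbb{F}_m$ be the last field of a radical tower over $\mathbb{C}(x)$. Consider a system of $l$ linear ODEs with unknowns $y_1(x),\ldots,y_n(x)$ and coefficients $a^{(k)}_{i,j}(x)\in\mathbb{F}_m$: \[ \sum_{i=1}^{n}\sum_{j\ge 0} a^{(k)}_{i,j}\cdot y_i^{(j)} = b^{(k)},\qquad k=1,\ldots,l, \] where the sums are finite (the superindex $k$ in $a^{(k)}_{i,j}$ denotes the equation, $i$ denotes the unknown and $j$ its derivation order). Then, for every non-constant $r(z)\in\mathbb{C}(z)$ the following are equivalent: \begin{enumerate} \item All of the $a_{i,j}^{(k)}(r(z))$ are rational. \item The system resulting from the reparametrization $x=r(z)$ has rational coefficients. \end{enumerate}
   Context: A radical tower over $\mathbb{C}(x)$ is a chain of fields $\mathbb{F}_0=\mathbb{C}(x)\subseteq\dots\subseteq\mathbb{F}_{m}$ with $\mathbb{F}_i=\mathbb{F}_{i-1}(\delta_i)=\mathbb{F}_0(\delta_1,\ldots,\delta_i)$, where $\delta_i^{e_i}=\alpha_i\in\mathbb{F}_{i-1}$ and $e_i\in\mathbb{N}$ is positive. Elements of $\mathbb{F}_m$ are regarded as functions of $x$ after a choice of branches of the radicals, and $a(r(z))$ denotes the composite function; it is rational if it is an element of $\mathbb{C}(z)$. The system resulting from $x=r(z)$ is the linear system in the unknowns $Y_i(z)=y_i(r(z))$ obtained by replacing $x$ by $r(z)$ in the $a^{(k)}_{i,j}$ and $b^{(k)}$ and replacing $y_i^{(j)}(r(z))$ by its expression via the chain rule, $y_i^{(j)}(r(z))=\left(\frac{1}{r'(z)}\frac{d}{dz}\right)^{j}Y_i(z)$,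 and collecting terms in the $Y_i^{(j)}(z)$. The coefficients of a linear system are the functions multiplying the unknowns and their derivatives (not the right-hand sides). *)

(* Defs.v *)
From HB Require Import structures.
From mathcomp Require Import all_boot all_order all_algebra complex.
From mathcomp Require Import all_classical all_reals all_analysis.

Set Implicit Arguments.
Unset Strict Implicit.
Unset Printing Implicit Defensive.

Import Order.TTheory GRing.Theory Num.Theory numFieldNormedType.Exports.
Local Open Scope classical_set_scope.
Local Open Scope ring_scope.

(* R[i] packaged as a numClosedFieldType, so that it gets the topology and the
   normed-module structure of a numFieldType; [derivable] and [derive1] on it
   are complex differentiability and the complex derivative. *)
Definition Cplx (R : realType) : numClosedFieldType := R[i].

Section Functions.
Variable R : realType.
Local Notation C := (Cplx R).

(* The field C(x). *)
Definition ratfield : fieldType := {fraction {poly C}}.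

(* Evaluation through the representative of f stored in the quotient: this is
   the value of f off the finitely many zeros of that denominator; at those
   zeros the result is 0 and carries no meaning. *)
Definition reval (f : ratfield) (z : C) : C :=
  (frac (repr f)).1.[z] / (frac (repr f)).2.[z].

Definition ratconst (c : C) : ratfield := FracField.tofrac c%:P.

Definition nonconstant (r : ratfield) : Prop := forall c : C, r <> ratconst c.

Definition is_domain (U : set C) : Prop := [/\ open U, connected U & U !=set0].

(* P holds on U off a subset that is closed and discrete in U: this is how
   equality of meromorphic functions on U reads for total functions C -> C,
   whose values at poles are junk. *)
Definition generic (U : set C) (P : C -> Prop) : Prop :=
  forall x, U x -> \forall y \near x^', P y.

(* g, as a function on U, is an element of C(z). *)
Definition rational_on (U : set C) (g : C -> C) : Prop :=
  exists q : ratfield, generic U (fun z => g z = reval q z).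

End Functions.

Section RadicalTower.
Variables (R : realType) (L : fieldType) (iota : {rmorphism ratfield R -> L}).

(* E = K(d), the least subfield containing K and d. *)
Definition is_adjoin (K : {pred L}) (d : L) (E : {pred L}) : Prop :=
  [/\ GRing.divring_closed E, {subset K <= E}, d \in E &
      forall S : {pred L}, GRing.divring_closed S -> {subset K <= S} ->
        d \in S -> {subset E <= S}].

(* A radical tower with last field L, C(x) being embedded in L by iota.
   [tower_gen i] is delta_(i+1) and [tower_exp i] is e_(i+1); the radicand
   alpha_(i+1) is [tower_gen i ^+ tower_exp i]. Only [tower_field i] for
   i <= m and [tower_gen i], [tower_exp i] for i < m are relevant. *)
Record radical_tower (m : nat) := RadicalTower {
  tower_field : nat -> {pred L};
  tower_gen : nat -> L;
  tower_exp : nat -> nat;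
  tower_base : forall y, y \in tower_field 0%N <-> exists f, y = iota f;
  tower_exp_gt0 : forall i, (i < m)%N -> (0 < tower_exp i)%N;
  tower_radical : forall i, (i < m)%N ->
    tower_gen i ^+ tower_exp i \in tower_field i;
  tower_adjoin : forall i, (i < m)%N ->
    is_adjoin (tower_field i) (tower_gen i) (tower_field i.+1);
  tower_last : forall y, y \in tower_field m
}.

(* A choice of branches on U: a morphism of fields from L to the meromorphic
   functions on U that sends each element of C(x) to the corresponding rational
   function. In particular [branch delta_i ^+ e_i] is generically
   [branch alpha_i]. *)
Record branches (U : set (Cplx R)) := Branches {
  branch :> L -> Cplx R -> Cplx R;
  branch_holomorphic : forall a, generic U (fun x => derivable (branch a) x 1);
  branchD : forall a b,
    generic U (fun x => branch (a + b) x = branch a x + branch b x);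
  branchM : forall a b,
    generic U (fun x => branch (a * b) x = branch a x * branch b x);
  branch_ratfield : forall f,
    generic U (fun x => branch (iota f) x = reval f x)
}.

End RadicalTower.

Section LinearSystems.
Variable R : realType.
Local Notation C := (Cplx R).

(* The system, for k : 'I_l,
     \sum_(i < n) \sum_(j < d) coef k i j * y_i^(j) = rhs k. *)
Record linear_system (l n d : nat) := LinearSystem {
  coef : 'I_l -> 'I_n -> 'I_d -> C -> C;
  rhs : 'I_l -> C -> C
}.

(* P : nat -> C -> C stands for the operator Y |-> \sum_k P k * Y^(k), and
   [diffop_comp P] is d/dz composed with it:
     (P k * Y^(k))^' = (P k)^' * Y^(k) + P k * Y^(k.+1). *)
Definition diffop_comp (P : nat -> C -> C) : nat -> C -> C := fun k z =>
  derive1 (P k) z + (if k is k'.+1 then P k' z else 0).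

(* The operator (1/r' d/dz)^j, written \sum_k chain_op r j k * (d/dz)^k. *)
Definition chain_op (r : C -> C) (j : nat) : nat -> C -> C :=
  iter j (fun P k z => (derive1 r z)^-1 * diffop_comp P k z)
    (fun k _ => (k == 0%N)%:R).

(* The system resulting from x = r(z): y_i^(j)(r(z)) is replaced by
   \sum_k chain_op r j k z * Y_i^(k)(z) and the terms in Y_i^(k) are collected;
   chain_op r j k = 0 for k > j, so the orders stay below d. *)
Definition reparametrize (l n d : nat) (r : C -> C) (S : linear_system l n d) :
  linear_system l n d :=
  LinearSystem
    (fun k i q z => \sum_(j < d) coef S k i j (r z) * chain_op r j q z)
    (fun k z => rhs S k (r z)).

Definition rational_coefs (l n d : nat) (V : set C) (S : linear_system l n d) :
  Prop := forall k i j, rational_on V (coef S k i j).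

End LinearSystems.

(* Main.v *)
Require Import Defs.
From HB Require Import structures.
From mathcomp Require Import all_boot all_order all_algebra complex.
From mathcomp Require Import all_classical all_reals all_analysis.
From mathcomp Require Import ring.

Set Implicit Arguments.
Unset Strict Implicit.
Unset Printing Implicit Defensive.

Import Order.TTheory GRing.Theory Num.Theory numFieldNormedType.Exports.
Local Open Scope classical_set_scope.
Local Open Scope ring_scope.

(** By the chain rule, the coefficient of Y_i^(q) in the system resulting from
    x = r(z) is the sum over j >= q of a_(i,j)(r(z)) times the coefficient of
    (d/dz)^q in the operator (1/r' d/dz)^j. The latter coefficients form a
    triangular matrix: they vanish for q > j, and the diagonal one is
    (1/r')^j ([chain_op_gt], [chain_op_diag]). Their entries are rational,
    because the functions that agree with an element of C(z) off a discrete set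
    form a differential field ([rational_onD], [rational_onM], [rational_onV],
    [rational_on_derive1]). The matrix is invertible over C(z), because in
    characteristic 0 a fraction with zero derivative is a constant, so that
    r' <> 0 for non-constant r ([wronskian_eq0], [derive1_reval_neq0]). So the
    functions a_(i,j)(r(z)) are all rational if and only if their images under
    this matrix are; back-substitution from the highest order downwards gives
    the converse ([rational_on_chain_rule]). The equivalence holds separately
    for each equation and each unknown. *)

(** * Fractions of polynomials with zero derivative *)

Lemma lead_coef_deriv (F : numFieldType) (p : {poly F}) :
  lead_coef p^`() = lead_coef p *+ (size p).-1.
Proof.
case sp: (size p) => [|[|k]] /=.
- by move/eqP: sp; rewrite size_poly_eq0 => /eqP->; rewrite deriv0 lead_coef0.
- have /eqP/size_poly1P[c _ ->] := sp.
  by rewrite derivC lead_coef0.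
have lp : p`_k.+1 != 0.
  rewrite -[k.+1]/(k.+2.-1) -sp -lead_coefE.
  by rewrite lead_coef_eq0 -size_poly_eq0 sp.
have sp' : size p^`() = k.+1.
  apply/eqP; rewrite eqn_leq -ltnS -{1}sp lt_size_deriv -?size_poly_eq0 ?sp //=.
  rewrite ltnNge; apply/negP => /(nth_default 0)/eqP.
  by rewrite coef_deriv mulrn_eq0 (negPf lp).
by rewrite !lead_coefE sp' sp coef_deriv.
Qed.

(** In degree deg n + deg d - 1, the coefficients of n' d and n d' are the product
    of the two leading coefficients times deg n and deg d respectively, so a
    nonzero n has the degree of d. Subtracting from n the multiple of d with the
    same leading coefficient keeps the relation but lowers the degree, so the
    difference must be 0. *)
Lemma wronskian_eq0 (F : numFieldType) (n d : {poly F}) : d != 0 ->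
  n^`() * d = n * d^`() -> exists c, n = c *: d.
Proof.
move=> d0 w.
have size_eq (p : {poly F}) :
    p^`() * d = p * d^`() -> p != 0 -> size p = size d.
  move=> wp p0; move/(congr1 lead_coef): wp.
  rewrite !lead_coefM !lead_coef_deriv mulrnAl mulrnAr.
  rewrite -[LHS]mulr_natr -[RHS]mulr_natr => /(mulfI _)/eqP.
  rewrite mulf_neq0 ?lead_coef_eq0 // eqr_nat => /(_ isT)/eqP.
  move: p0 d0; rewrite -!size_poly_gt0.
  by move: (size p) (size d) => [|?] [|?] //= _ _ ->.
have [->|n0] := eqVneq n 0; first by exists 0; rewrite scale0r.
pose c := lead_coef n / lead_coef d; exists c; apply/eqP.
rewrite -subr_eq0; set p := n - _; apply: contraT => p0.
have sp : size p = size d.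
  apply: (size_eq _ _ p0).
  by rewrite derivB derivZ !mulrBl w -!scalerAl [d^`() * d]mulrC.
move: p0; rewrite -lead_coef_eq0 lead_coefE sp coefB coefZ.
rewrite -{1}(size_eq n w n0) -!lead_coefE divfK ?subrr ?eqxx //.
by rewrite lead_coef_eq0.
Qed.

(** * Punctured neighbourhoods and derivatives *)

Section Analysis.
Variable K : numFieldType.

Lemma is_derive_horner (p : {poly K}) (x : K) :
  is_derive x (1 : K) (horner p) p^`().[x].
Proof.
elim/poly_ind: p => [|p c IHp].
  have -> : horner (0 : {poly K}) = cst 0 by apply/funext => y; rewrite horner0.
  by rewrite deriv0 horner0; exact: is_derive_cst.
have -> : horner (p * 'X + c%:P) = (horner p * id + cst c)%R.
  by apply/funext => y; rewrite hornerMXaddC.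
apply: is_derive_eq.
rewrite derivMXaddC !hornerE /GRing.scale /=.
by ring.
Qed.

Lemma derive1_quotient (n d : {poly K}) (z : K) : d.[z] != 0 ->
  derive1 (fun y => n.[y] / d.[y]) z =
    (n^`() * d - n * d^`()).[z] / (d ^+ 2).[z].
Proof.
move=> dz; have dn := is_derive_horner n z; have dd := is_derive_horner d z.
rewrite derive1E.
have -> : (fun y => n.[y] / d.[y]) = (horner n * (fun y => (horner d y)^-1))%R.
  by [].
rewrite deriveM ?deriveV ?derive_val //; last exact: derivableV.
rewrite !hornerE /GRing.scale /=; field.
by rewrite dz.
Qed.

Lemma near_neq (x a : K) : x != a -> \forall y \near x, y != a.
Proof.
move=> /eqP xa; apply: (@filterS _ (nbhs x) _ (~` [set a])) => [y /eqP//|].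
apply: open_nbhs_nbhs; split=> //.
apply/closed_openC/accessible_closed_set1/hausdorff_accessible.
exact: norm_hausdorff.
Qed.

(** A punctured neighbourhood can be taken open, hence is a neighbourhood of
    each of its points. This is what makes generic equality compatible with
    differentiation. *)
Lemma near_dnbhs_near (P : set K) (x : K) :
  (\forall y \near x^', P y) -> \forall y \near x^', \near y, P y.
Proof.
rewrite /dnbhs !near_withinE => /near_join; apply: filterS => y Py yx.
have : \forall z \near y, z != x.
  exact: near_neq.
by move: Py; apply: filterS2 => z /[apply].
Qed.

Lemma near_dnbhs_derive1 (f g : K -> K) (x : K) :
  (\forall y \near x^', f y = g y) ->
  \forall y \near x^', derive1 f y = derive1 g y.
Proof.
move/near_dnbhs_near; apply: filterS => y fg.
by rewrite !derive1E; exact: near_eq_derive.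
Qed.

Lemma near_dnbhs_neq (x a : K) : \forall y \near x^', y != a.
Proof.
have [->|xa] := eqVneq a x; first exact: nbhs_dnbhs_neq.
by apply: nbhs_dnbhs; apply: near_neq; rewrite eq_sym.
Qed.
End Analysis.

Lemma near_dnbhs_horner_neq0 (K : numClosedFieldType) (p : {poly K}) (x : K) :
  p != 0 -> \forall y \near x^', p.[y] != 0.
Proof.
move=> p0; have [rs ->] := closed_field_poly_normal p.
rewrite -lead_coef_eq0 in p0; elim: rs => [|a rs IHrs].
  by apply: nearW => y; rewrite big_nil alg_polyC hornerC.
apply: filterS2 IHrs (near_dnbhs_neq x a) => y.
rewrite big_cons !hornerE !mulf_eq0 !negb_or => /andP[-> ->] ya.
by rewrite subr_eq0 ya.
Qed.

(** * The differential field of generically rational functions *)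

Section Rational.
Variable R : realType.
Local Notation C := (Cplx R).

Lemma ratfieldE (f : ratfield R) :
  f = FracField.tofrac (frac (repr f)).1 / FracField.tofrac (frac (repr f)).2.
Proof.
rewrite -[LHS]reprK; case: (repr f) => -[n d] /= d0.
unlock FracField.tofrac; rewrite -[_^-1]FracField.pi_inv -[RHS]FracField.pi_mul.
rewrite /FracField.mulf /FracField.invf.
rewrite !(numer_Ratio, denom_Ratio) ?oner_eq0 // mulr1 mul1r; apply: congr1; apply: val_inj => /=.
by rewrite [RHS]surjective_pairing numer_Ratio ?denom_Ratio.
Qed.

(** [reval] depends on the representative stored in the quotient, so this is not
    an equality of functions: it can fail at zeros of the two denominators. *)
Lemma reval_quotient (V : set C) (n d : {poly C}) : d != 0 ->
  generic V (fun z =>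
    reval (FracField.tofrac n / FracField.tofrac d) z = n.[z] / d.[z]).
Proof.
move=> d0 x _; set f := _ / _; rewrite /reval.
have : (frac (repr f)).2 != 0 := denom_ratioP _.
have := ratfieldE f; set n1 := (frac (repr f)).1; set d1 := (frac (repr f)).2.
rewrite /f => /eqP + d10.
rewrite eqr_div ?tofrac_eq0 // -!tofracM tofrac_eq => /eqP nd.
apply: filterS2 (near_dnbhs_horner_neq0 x d0) (near_dnbhs_horner_neq0 x d10).
move=> y dy d1y; apply/eqP; rewrite eqr_div // -!hornerM.
by rewrite nd.
Qed.

(** Polynomials n and d, unlike an element of the fraction field, can be
    evaluated and differentiated directly; all closure properties go through
    this form. *)
Lemma rational_onP (V : set C) (g : C -> C) :
  rational_on V g <-> exists (n d : {poly C}), d != 0 /\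
    generic V (fun z => g z = n.[z] / d.[z]).
Proof.
split=> [[q gq]|[n [d [d0 gq]]]].
  exists (frac (repr q)).1, (frac (repr q)).2; split; first exact: denom_ratioP.
  exact: gq.
exists (FracField.tofrac n / FracField.tofrac d) => x Vx.
by apply: filterS2 (gq x Vx) (reval_quotient n d0 Vx) => y -> ->.
Qed.

Lemma rational_on_reval (V : set C) (q : ratfield R) : rational_on V (reval q).
Proof. by exists q => x _; apply: nearW. Qed.

Lemma eq_rational_on (V : set C) (f g : C -> C) :
  generic V (fun z => f z = g z) -> rational_on V g -> rational_on V f.
Proof.
move=> fg [q gq]; exists q => x Vx.
by apply: filterS2 (fg x Vx) (gq x Vx) => y -> ->.
Qed.

Lemma rational_on_cst (V : set C) (c : C) : rational_on V (fun=> c).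
Proof.
apply/rational_onP; exists c%:P, 1; split; first exact: oner_neq0.
by move=> x _; apply: nearW => y; rewrite !hornerE divr1.
Qed.

Lemma rational_onM (V : set C) (f g : C -> C) :
  rational_on V f -> rational_on V g -> rational_on V (fun z => f z * g z).
Proof.
move=> /rational_onP[n [d [d0 fE]]] /rational_onP[p [q [q0 gE]]].
apply/rational_onP; exists (n * p), (d * q).
split=> [|x Vx]; first by rewrite mulf_neq0.
apply: filterS2 (fE x Vx) (gE x Vx) => y -> ->.
by rewrite !hornerM mulf_div.
Qed.

Lemma rational_onD (V : set C) (f g : C -> C) :
  rational_on V f -> rational_on V g -> rational_on V (fun z => f z + g z).
Proof.
move=> /rational_onP[n [d [d0 fE]]] /rational_onP[p [q [q0 gE]]].
apply/rational_onP; exists (n * q + p * d), (d * q).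
split=> [|x Vx]; first by rewrite mulf_neq0.
have dq0 : d * q != 0 by rewrite mulf_neq0.
apply: filterS3 (near_dnbhs_horner_neq0 x dq0) (fE x Vx) (gE x Vx) => y + -> ->.
by rewrite hornerM mulf_eq0 negb_or => /andP[dy qy]; rewrite addf_div ?hornerE.
Qed.

Lemma rational_onV (V : set C) (f : C -> C) :
  rational_on V f -> rational_on V (fun z => (f z)^-1).
Proof.
move=> /rational_onP[n [d [d0 fE]]].
(* If f is generically 0, its pointwise inverse is again 0, since 0^-1 = 0. *)
have [n0|n0] := eqVneq n 0.
  apply: eq_rational_on (rational_on_cst V 0) => x Vx.
  by apply: filterS (fE x Vx) => y ->; rewrite n0 horner0 mul0r invr0.
apply/rational_onP; exists d, n; split=> // x Vx.
by apply: filterS (fE x Vx) => y ->; rewrite invf_div.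
Qed.

Lemma rational_onN (V : set C) (f : C -> C) :
  rational_on V f -> rational_on V (fun z => - f z).
Proof.
move=> fr; apply: eq_rational_on (rational_onM (rational_on_cst V (-1)) fr).
by move=> x _; apply: nearW => y; rewrite mulN1r.
Qed.

Lemma rational_on_sum (V : set C) (I : Type) (s : seq I) (P : pred I)
    (F : I -> C -> C) : (forall i, P i -> rational_on V (F i)) ->
  rational_on V (fun z => \sum_(i <- s | P i) F i z).
Proof.
move=> FP; elim: s => [|i s IHs].
  by under eq_fun => z do rewrite big_nil; exact: rational_on_cst.
under eq_fun => z do rewrite big_cons.
by case: (P i) (FP i) => // Fi; apply: rational_onD IHs; exact: Fi.
Qed.

Lemma rational_onX (V : set C) (f : C -> C) (k : nat) :
  rational_on V f -> rational_on V (fun z => f z ^+ k).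
Proof.
move=> fr; elim: k => [|k IHk]; first exact: rational_on_cst.
by under eq_fun => z do rewrite exprS; apply: rational_onM.
Qed.

Lemma rational_on_derive1 (V : set C) (f : C -> C) :
  rational_on V f -> rational_on V (derive1 f).
Proof.
move=> /rational_onP[n [d [d0 fE]]].
apply/rational_onP; exists (n^`() * d - n * d^`()), (d ^+ 2).
split=> [|x Vx]; first by rewrite expf_neq0.
apply: filterS2 (near_dnbhs_derive1 (fE x Vx)) (near_dnbhs_horner_neq0 x d0).
by move=> y -> dy; rewrite derive1_quotient.
Qed.

(** The derivative of n / d is (n' d - n d') / d^2, whose numerator is a nonzero
    polynomial by [wronskian_eq0], hence has isolated zeros. *)
Lemma derive1_reval_neq0 (V : set C) (r : ratfield R) : nonconstant r ->
  generic V (fun z => derive1 (reval r) z != 0).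
Proof.
move=> rc x _.
have d0 : (frac (repr r)).2 != 0 := denom_ratioP _.
have := ratfieldE r; rewrite /reval.
move: (frac (repr r)).1 (frac (repr r)).2 d0 => n d d0 rE.
have w0 : n^`() * d - n * d^`() != 0.
  apply/eqP => /subr0_eq /(wronskian_eq0 d0)[c nE]; apply: (rc c).
  by rewrite rE nE -mul_polyC tofracM mulfK // tofrac_eq0.
apply: filterS2 (near_dnbhs_horner_neq0 x d0) (near_dnbhs_horner_neq0 x w0).
move=> y dy wy; rewrite derive1_quotient // mulf_neq0 // invr_eq0.
by rewrite horner_exp expf_neq0.
Qed.

(** * The operators (1/r' d/dz)^j *)

Lemma chain_opS (r : C -> C) (j k : nat) :
  chain_op r j.+1 k =
    fun z => (derive1 r z)^-1 * diffop_comp (chain_op r j) k z.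
Proof. by []. Qed.

Lemma chain_op_rational (V : set C) (r : C -> C) (j k : nat) :
  rational_on V r -> rational_on V (chain_op r j k).
Proof.
move=> rr; elim: j k => [|j IHj] k; first exact: rational_on_cst.
rewrite chain_opS; apply: rational_onM.
  exact/rational_onV/rational_on_derive1.
apply: rational_onD; first exact: rational_on_derive1.
by case: k => [|k //]; exact: rational_on_cst.
Qed.

Lemma chain_op_gt (r : C -> C) (j k : nat) : (j < k)%N ->
  chain_op r j k = cst 0.
Proof.
elim: j k => [|j IHj] [|k] // jk; apply/funext => z.
have jk1 : (j < k.+1)%N by rewrite ltnW.
rewrite chain_opS /diffop_comp (IHj k.+1 jk1) (IHj k jk).
by rewrite derive1_cst addr0 mulr0.
Qed.

Lemma chain_op_diag (r : C -> C) (j : nat) (z : C) :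
  chain_op r j j z = (derive1 r z)^-1 ^+ j.
Proof.
elim: j => [//|j IHj].
rewrite chain_opS /diffop_comp (chain_op_gt _ (ltnSn j)).
by rewrite derive1_cst add0r IHj exprS.
Qed.

(** From left to right, [chain_op] is rational. From right to left, the q-th
    combination equals [A q] / r'^q plus terms with j > q, so the [A q] are
    recovered one at a time from the highest index down. *)
Lemma rational_on_chain_rule (V : set C) (r : ratfield R) (d : nat)
    (A : 'I_d -> C -> C) : nonconstant r ->
  (forall j, rational_on V (A j)) <->
  (forall q : 'I_d,
    rational_on V (fun z => \sum_(j < d) A j z * chain_op (reval r) j q z)).
Proof.
move=> rc; have rr := rational_on_reval V r.
split=> [Ar q|Br].
  apply: rational_on_sum => j _; apply: rational_onM => //.
  exact: chain_op_rational.
(* The induction on m runs through the indices q from d - 1 downwards. *)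
suff H m (q : 'I_d) : (d - q <= m)%N -> rational_on V (A q).
  by move=> q; exact: H (leqnn _).
elim: m q => [|m IHm] q; first by rewrite leqn0 subn_eq0 leqNgt ltn_ord.
move=> dqm.
(* T collects the terms of order above q, already known to be rational. *)
pose T z := \sum_(j < d | (q < j)%N) A j z * chain_op (reval r) j q z.
have Tr : rational_on V T.
  apply: rational_on_sum => j qj; apply: rational_onM; last first.
    exact: chain_op_rational.
  by apply: IHm; rewrite -ltnS (leq_trans _ dqm) // ltn_sub2l.
have Er := rational_onM (rational_onD (Br q) (rational_onN Tr))
  (rational_onX q (rational_on_derive1 rr)).
apply: eq_rational_on Er => x _.
apply: filterS (derive1_reval_neq0 (V := setT) rc (x := x) I) => y r'y.
rewrite (bigID (fun j : 'I_d => (q < j)%N)) /= addrAC subrr add0r.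
rewrite (bigD1 q) ?ltnn //= big1 ?addr0 => [|j /andP[jq nqj]].
  by rewrite chain_op_diag -mulrA -exprMn mulVf // expr1n mulr1.
by rewrite chain_op_gt ?mulr0 // ltn_neqAle nqj leqNgt.
Qed.
End Rational.

(** * Systems of linear differential equations *)

Theorem theorem4p1 (R : realType) (L : fieldType)
  (iota : {rmorphism ratfield R -> L}) (m : nat) (tower : radical_tower iota m)
  (U : set (Cplx R)) (hU : is_domain U) (ev : branches iota U)
  (l n d : nat) (a : 'I_l -> 'I_n -> 'I_d -> L) (b : 'I_l -> Cplx R -> Cplx R)
  (r : ratfield R) (hr : nonconstant r)
  (V : set (Cplx R)) (hV : is_domain V) (hVU : generic V (fun z => U (reval r z))) :
  (forall k i j, rational_on V (fun z => ev (a k i j) (reval r z))) <->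
  rational_coefs V
    (reparametrize (reval r) (LinearSystem (fun k i j => ev (a k i j)) b)).
Proof.
have chain k i :=
  rational_on_chain_rule V (fun j z => ev (a k i j) (reval r z)) hr.
by split=> rat k i; have [to from] := chain k i; [exact/to/rat|exact/from/rat].
Qed.
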